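(* Let $N\ge1$, $a=b=c=d=1$ and $\theta_1,\theta_2\in[0,1]$. In the interacting particle system of the six-vertex model on the strip of width $N$ on any down-right path, the parity of the number of particles $\sum_i\tau_i$ is preserved. Suppose moreover $(1-\theta_1)(1-\theta_2)\neq0$ and let $\mathcal P$ be a down-right path with outgoing edges $p_1,\dots,p_N\in\{\uparrow,\rightarrow\}$. Then the following product measure $\mu_{\mathcal P}$ on $\{0,1\}^N$ is a stationary measure of the six-vertex model on the strip on $\mathcal P$: the $\tau_i$ are independent, $\tau_i$ is Bernoulli with $\mathbb P(\tau_i=1)=p^\uparrow$ when $p_i=\uparrow$ and Bernoulli with $\mathbb P(\tau_i=1)=p^\rightarrow$ when $p_i=\rightarrow$, where $$p^\uparrow=\frac{\sqrt{1-\theta_2}}{\sqrt{1-\theta_1}+\sqrt{1-\theta_2}},\qquad p^\rightarrow=\frac{\sqrt{1-\theta_1}}{\sqrt{1-\theta_1}+\sqrt{1-\theta_2}}.$$ Furthermore, restricting $\mu_{\mathcal P}$ to the set of states with an even (respectively odd) number of particles and normalizing gives two stationary measures.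
   Context: Strip and paths. Fix an integer $N\ge 1$. The strip of width $N$ is $\{(x,y)\in\mathbb Z^2: 0\le y\le x\le y+N\}$, with an edge between any two of its vertices at distance 1; each edge can carry at most one (up or right) arrow. Vertices $(y,y)$ are left boundary vertices, $(y+N,y)$ are right boundary vertices, all others are bulk vertices. The left/bottom edges at a vertex (those lying in the strip) are its incoming edges, the right/top ones its outgoing edges. Thus a left boundary vertex has at most a bottom incoming edge and a right outgoing edge; a right boundary vertex has a left incoming edge and a top outgoing edge. A down-right path $\mathcal P$ is a path in the strip from a left boundary vertex to a right boundary vertex with each step going down or right by 1 (so it has $N$ steps). Its outgoing edges are the edges going up or right from a vertex of $\mathcal P$ to a vertex not on $\mathcal P$; there are exactly $N$, labelled $p_1,\dots,p_N$ from up-left to down-right ($p_i$ is the unique one joining the lines $x-y=i-1$ and $x-y=i$); we write $p_i=\uparrow$ if this edge is vertical and $p_i=\rightarrow$ if it is horizontal. An outgoing configuration of $\mathcal P$ is $\tau=(\tau_1,\dots,\tau_N)\in\{0,1\}^N$, $\tau_i=1$ iff $p_i$ carries an arrow. Six-vertex dynamics. Let $\mathcal Q$ be a down-right path lying (weakly) above $\mathcal P$. Given an outgoing configuration of $\mathcal P$, sample sequentially the outgoing edges of all vertices between $\mathcal P$ and $\mathcal Q$, including those on $\mathcal Q$ and excluding those on $\mathcal P$, in order of increasing $y$ and, for equal $y$, increasing $x$, independently given the incoming edges, as follows. Bulk vertex: if both (resp. neither) incoming edges carry arrows, both (resp. neither) outgoing edges do; if only the left incoming edge carries an arrow, it exits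 to the right with probability $\theta_2$ and to the top with probability $1-\theta_2$; if only the bottom incoming edge carries an arrow, it exits to the top with probability $\theta_1$ and to the right with probability $1-\theta_1$. Left boundary vertex: if the bottom edge carries an arrow, the right edge carries one with probability $1-c$ (none with probability $c$); if the bottom edge is empty, the right edge carries an arrow with probability $a$ (none with probability $1-a$). Right boundary vertex: if the left edge carries an arrow, the top edge carries one with probability $1-b$ (none with probability $b$); if the left edge is empty, the top edge carries an arrow with probability $d$ (none with probability $1-d$). (With $a=b=c=d=1$ an arrow reaching the boundary exits the system, and an arrow enters at a boundary vertex exactly when no arrow reaches it: ''anti-reflecting'' boundary.) This defines a transition matrix $P_{\mathcal P,\mathcal Q}(\tau,\tau')$ from outgoing configurations of $\mathcal P$ to those of $\mathcal Q$. Particle system on $\mathcal P$. Let $\mathcal P_k=\mathcal P+(k,k)$. The interacting particle system of the six-vertex model on the strip on $\mathcal P$ is the time-homogeneous Markov chain on $\{0,1\}^N$ with transition matrix $P_{\mathcal P_k,\mathcal P_{k+1}}=P_{\mathcal P,\mathcal P_1}$. A stationary measure of this chain is called a stationary measure of the six-vertex model on a strip on $\mathcal P$ (it need not be unique here). *)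

(* Defs.v *)
From mathcomp Require Import all_boot all_order all_algebra.

Set Implicit Arguments.
Unset Strict Implicit.
Unset Printing Implicit Defensive.

Import Order.TTheory GRing.Theory Num.Theory.

(* All vertices of the strip have nonnegative coordinates. *)
Definition vertex : Type := (nat * nat)%type.

Definition in_strip (N : nat) (v : vertex) : bool :=
  (v.2 <= v.1) && (v.1 <= v.2 + N).

Definition left_boundary (v : vertex) : bool := v.1 == v.2.

Definition right_boundary (N : nat) (v : vertex) : bool := v.1 == v.2 + N.

(* An edge is given by its lower/left endpoint together with a boolean that is
   [true] for an up edge and [false] for a right edge. *)
Definition edge : Type := (vertex * bool)%type.

Definition vertical (e : edge) : bool := e.2.

Definition target (e : edge) : vertex :=
  if vertical e then (e.1.1, e.1.2.+1) else (e.1.1.+1, e.1.2).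

Definition up_edge (v : vertex) : edge := (v, true).
Definition right_edge (v : vertex) : edge := (v, false).

(* The predecessors are only taken at vertices lying strictly above a
   down-right path; there both coordinates are positive. *)
Definition left_in (v : vertex) : edge := right_edge (v.1.-1, v.2).
Definition bottom_in (v : vertex) : edge := up_edge (v.1, v.2.-1).

Definition downright_step (u v : vertex) : bool :=
  (v == (u.1.+1, u.2)) || (u == (v.1, v.2.+1)).

(* A path is the sequence of its successive vertices. *)
Definition downright_path (N : nat) (P : seq vertex) : bool :=
  if P is v :: P' then
    [&& all (in_strip N) P, path downright_step v P',
        left_boundary v & right_boundary N (last v P')]
  else false.

(* Going along the path and listing, at each vertex, the up edge before the
   right edge enumerates the outgoing edges from up-left to down-right: at a
   vertex of the line x - y = k the up edge joins the lines x - y = k - 1 and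
   x - y = k, the right edge the lines x - y = k and x - y = k + 1. *)
Definition out_edges (N : nat) (P : seq vertex) : seq edge :=
  [seq e <- [seq (v, up) | v <- P, up <- [:: true; false]]
     | in_strip N (target e) && (target e \notin P)].

(* Indices start at 0: [out_edge P i] is the edge p_{i+1}, joining the lines
   x - y = i and x - y = i + 1. *)
Definition out_edge (N : nat) (P : seq vertex) (i : 'I_N) : edge :=
  nth (up_edge (0, 0)) (out_edges N P) i.

Definition same_line (u v : vertex) : bool := u.1 + v.2 == v.1 + u.2.

Definition strictly_above (P : seq vertex) (v : vertex) : bool :=
  has (fun u => same_line u v && (u.2 < v.2)) P.

Definition weakly_below (Q : seq vertex) (v : vertex) : bool :=
  has (fun u => same_line u v && (v.2 <= u.2)) Q.

(* The vertices between P and Q (those on Q included, those on P excluded),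
   by increasing y and, for equal y, by increasing x. *)
Definition between (P Q : seq vertex) : seq vertex :=
  [seq v <- [seq (x, y) | y <- iota 0 (\max_(v <- Q) v.2).+1,
                          x <- iota 0 (\max_(v <- Q) v.1).+1]
     | strictly_above P v && weakly_below Q v].

Definition shift_path (k : nat) (P : seq vertex) : seq vertex :=
  [seq (v.1 + k, v.2 + k) | v <- P].

Local Open Scope ring_scope.

Record rates (R : Type) := Rates {
  rate_a : R; rate_b : R; rate_c : R; rate_d : R;
  rate_theta1 : R; rate_theta2 : R }.

Definition config : Type := edge -> bool.

Notation state N := {ffun 'I_N -> bool}.

Definition bernoulli_prob (R : pzRingType) (p : R) (x : bool) : R :=
  if x then p else 1 - p.

(* Probability that the top and right edges of v carry arrows according to t
   and r, given that its left and bottom edges do according to l and b. At a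
   boundary vertex the missing outgoing edge is always empty and the missing
   incoming edge is ignored. *)
Definition vertex_prob (R : pzRingType) (prm : rates R) (N : nat) (v : vertex)
    (l b t r : bool) : R :=
  if left_boundary v then
    if t then 0
    else bernoulli_prob (if b then 1 - rate_c prm else rate_a prm) r
  else if right_boundary N v then
    if r then 0
    else bernoulli_prob (if l then 1 - rate_b prm else rate_d prm) t
  else
    match l, b with
    | true, true => (t && r)%:R
    | false, false => (~~ t && ~~ r)%:R
    | true, false =>
        if t == r then 0 else bernoulli_prob (rate_theta2 prm) r
    | false, true =>
        if t == r then 0 else bernoulli_prob (rate_theta1 prm) t
    end.

Definition set_out (w : config) (v : vertex) (t r : bool) : config :=
  fun e => if e == up_edge v then t else if e == right_edge v then r else w e.

(* Probability of the event A after sampling, one after the other, the outgoing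
   edges of the vertices in vs, starting from the configuration w. *)
Fixpoint sample_prob (R : pzRingType) (prm : rates R) (N : nat)
    (vs : seq vertex) (w : config) (A : config -> bool) : R :=
  if vs is v :: vs' then
    \sum_(t : bool) \sum_(r : bool)
      vertex_prob prm N v (w (left_in v)) (w (bottom_in v)) t r
      * sample_prob prm N vs' (set_out w v t r) A
  else (A w)%:R.

(* Only the outgoing edges of P matter; all others are initially empty. *)
Definition config_of (N : nat) (P : seq vertex) (tau : state N) : config :=
  fun e => [exists i : 'I_N, (out_edge P i == e) && tau i].

Definition outgoing_state (N : nat) (Q : seq vertex) (w : config) : state N :=
  [ffun i => w (out_edge Q i)].

Definition transition (R : pzRingType) (prm : rates R) (N : nat)
    (P Q : seq vertex) (tau tau' : state N) : R :=
  sample_prob prm N (between P Q) (config_of P tau)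
    (fun w => outgoing_state N Q w == tau').

Definition particle_system (R : pzRingType) (prm : rates R) (N : nat)
    (P : seq vertex) : state N -> state N -> R :=
  @transition R prm N P (shift_path 1 P).

Definition num_particles (N : nat) (tau : state N) : nat :=
  (\sum_(i < N) tau i)%N.

Definition probability_measure (R : numDomainType) (N : nat)
    (mu : state N -> R) : Prop :=
  (forall tau, 0 <= mu tau) /\ \sum_tau mu tau = 1.

Definition stationary_measure (R : numDomainType) (prm : rates R) (N : nat)
    (P : seq vertex) (mu : state N -> R) : Prop :=
  probability_measure mu /\
  forall tau', \sum_tau mu tau * particle_system prm P tau tau' = mu tau'.

Definition bernoulli_product (R : comPzRingType) (N : nat) (p : 'I_N -> R)
    (tau : state N) : R :=
  \prod_(i < N) bernoulli_prob (p i) (tau i).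

Definition restrict_measure (R : fieldType) (N : nat) (mu : state N -> R)
    (A : pred (state N)) (tau : state N) : R :=
  if A tau then mu tau / \sum_(sigma | A sigma) mu sigma else 0.

(* Main.v *)
Require Import Defs.
From mathcomp Require Import all_boot all_order all_algebra.
From mathcomp Require Import zify ring.

Set Implicit Arguments.
Unset Strict Implicit.
Unset Printing Implicit Defensive.

Import Order.TTheory GRing.Theory Num.Theory.

(** A down-right path meets each line x - y = k with 0 <= k <= N in exactly one
    vertex, so it is recorded by the height h k of that vertex, and passing
    from P to P + (1,1) raises every h k by one.  The vertices to be sampled
    are visited in an order in which each visit is a corner flip: when line k
    is visited, the incoming edges of the new vertex are precisely the outgoing
    edges k - 1 and k of the current path (numbered from 0, and as far as they
    exist), and its outgoing edges replace them.  Hence the dynamics, defined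
    on all edges of the lattice, is a composition of Markov kernels on {0,1}^N,
    one for each line, each acting on two neighbouring sites (one site at the
    boundary lines 0 and N): this is [particle_system_flips].

    It then suffices to study one flip.

    Parity ([odd_flip]): a bulk vertex conserves the number of arrows, while an
    anti-reflecting boundary vertex turns an arrow into a hole and conversely,
    hence changes the parity.  As N >= 1, the sweep visits two distinct
    boundary lines, once each, and the two changes cancel.

    Stationarity ([flip_stationary]): a flip maps the product measure attached
    to the current path to the one attached to the flipped path.  In the bulk
    this is the statement that a vertex with independent inputs, right-going
    with probability p_right and up-going with probability p_up, has
    independent outputs with the same laws; given p_up + p_right = 1 it reduces
    to the balance
      p_right^2 (1 - theta2) = p_up^2 (1 - theta1)
    between the two ways of exchanging an arrow and a hole, which is what the
    square roots solve.  At the boundaries it says that the complement of a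
    Bernoulli(p_up) variable is Bernoulli(p_right), and conversely.  After a
    full sweep every edge direction is what it was at the start, so the product
    measure is stationary.

    Finally, the even and the odd states do not communicate, and both classes
    have positive mass, so conditioning on either one preserves stationarity
    ([stationary_restrict]). *)

(** * Down-right paths as height functions *)

Definition vert (h : nat -> nat) (k : nat) : vertex := (k + h k, h k).

Definition descending (N : nat) (h : nat -> nat) : Prop :=
  forall k, k < N -> (h k == h k.+1) || (h k == (h k.+1).+1).

(** The edge between the lines i and i + 1 that leaves the path of heights h:
    the path goes right between these lines when the heights agree, and then
    the edge goes up from the second vertex; otherwise the path goes down and
    the edge goes right from the first vertex. *)
Definition cut_edge (h : nat -> nat) (i : nat) : edge :=
  if h i == h i.+1 then up_edge (vert h i.+1) else right_edge (vert h i).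

(** The number i of the pair of lines x - y = i, x - y = i + 1 joined by an
    edge; it separates the edges leaving a path. *)
Definition gap (e : edge) : nat := e.1.1 - e.1.2 - e.2.

Lemma gap_cut_edge h i : gap (cut_edge h i) = i.
Proof. by rewrite /cut_edge /gap; case: ifP => _ /=; lia. Qed.

Lemma vertical_cut_edge h i : vertical (cut_edge h i) = (h i == h i.+1).
Proof. by rewrite /cut_edge; case: ifP. Qed.

Lemma eq_cut_edge h h' i :
  h i = h' i -> h i.+1 = h' i.+1 -> cut_edge h i = cut_edge h' i.
Proof. by rewrite /cut_edge /vert => -> ->. Qed.

Lemma nth_path_line (v : vertex) (P : seq vertex) (j : nat) :
  path downright_step v P -> v.2 <= v.1 -> j <= size P ->
  (nth v (v :: P) j).2 <= (nth v (v :: P) j).1 /\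
  (nth v (v :: P) j).1 - (nth v (v :: P) j).2 = v.1 - v.2 + j.
Proof.
move=> /(pathP v) step v_strip; elim: j => [|j IHj] jP; first by split=> //=; lia.
have [] := IHj (ltnW jP); have := step j jP; rewrite /downright_step /=.
move: (nth v P j) (nth v (v :: P) j) => [x y] [x' y'] /=.
by case/orP=> /eqP []; lia.
Qed.

Lemma downright_path_heights N P : downright_path N P ->
  exists2 h, P = [seq vert h k | k <- iota 0 N.+1] & descending N h.
Proof.
case: P => // v P /and4P[_ vP /eqP vl /eqP vr].
have line := @nth_path_line v P _ vP (eq_leq (esym vl)).
have sP : size P = N.
  have [] := line (size P) (leqnn _); rewrite vl subnn add0n.
  by rewrite -[size P]/((size (v :: P)).-1) nth_last /= vr; lia.
exists (fun k => (nth v (v :: P) k).2) => [|k kN].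
  apply: (@eq_from_nth _ v); first by rewrite size_map size_iota /= sP.
  rewrite [size _]/= sP => k kN.
  rewrite (nth_map 0) ?size_iota // nth_iota // add0n /vert.
  have [] := line k; first by rewrite sP.
  rewrite vl subnn add0n.
  by move: (nth v (v :: P) k) => [x y] /= le_yx; move/esym=> E; congr (_, _); lia.
move/(pathP v): vP => /(_ k); rewrite sP => /(_ kN) /=.
rewrite /downright_step /=.
by move: (nth v P k) (nth v (v :: P) k) => [x y] [x' y'] /= /orP[]/eqP[]; lia.
Qed.

Lemma mem_heights N h v :
  (v \in [seq vert h k | k <- iota 0 N.+1]) =
  [&& v.2 <= v.1, v.1 - v.2 <= N & v.2 == h (v.1 - v.2)].
Proof.
apply/mapP/and3P => [[k + ->]|[le1 le2 /eqP E]].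
  by rewrite mem_iota /= addnK; split=> //; lia.
exists (v.1 - v.2); first by rewrite mem_iota; lia.
by rewrite /vert -E subnK //; case: v {le1 le2 E}.
Qed.

(** The listing by vertices is compared with the listing by gaps on every
    initial segment of the path: the segment that ends on line m contributes
    the edges over the gaps below m, and over the gap m as well when that edge
    starts on line m, i.e. when the next step goes down. *)
Lemma out_edges_heights N h : descending N h ->
  out_edges N [seq vert h k | k <- iota 0 N.+1] =
  [seq cut_edge h i | i <- iota 0 N].
Proof.
move=> hh; rewrite /out_edges.
set P := [seq vert h k | k <- iota 0 N.+1].
set out := fun e => in_strip N (target e) && (target e \notin P).
have outup k : k <= N ->
    out (up_edge (vert h k)) = (0 < k) && (h k.-1 == h k).
  move=> kN; rewrite /out mem_heights /in_strip /=.
  case: k kN => [|k] kN /=; first by lia.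
  have -> : k.+1 + h k.+1 - (h k.+1).+1 = k by lia.
  by have := hh k kN; lia.
have outright k : k <= N ->
    out (right_edge (vert h k)) = (k < N) && (h k != h k.+1).
  move=> kN; rewrite /out mem_heights /in_strip /=.
  have -> : (k + h k).+1 - h k = k.+1 by lia.
  by lia.
suff prefix m : m <= N ->
    [seq e <- [seq (v, up) | v <- [seq vert h k | k <- iota 0 m.+1],
                             up <- [:: true; false]] | out e]
    = [seq cut_edge h i | i <- iota 0 m] ++
      (if (m < N) && (h m != h m.+1) then [:: cut_edge h m] else [::]).
  by rewrite prefix // ltnn cats0.
elim: m => [|m IHm] mN.
  rewrite /= [out _]outup // [out _]outright //=.
  by case: ifP => // /andP[_ /negPf E]; rewrite /cut_edge E.
have iotaSr n : iota 0 n.+1 = iota 0 n ++ [:: n] by rewrite -addn1 iotaD.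
rewrite (iotaSr m.+1) map_cat allpairs_cat filter_cat IHm ?(ltnW mN) //.
rewrite iotaSr map_cat -!catA mN; congr (_ ++ _).
rewrite /= [out _]outup // [out _]outright //= /cut_edge.
by case: (h m == _) => //=; case: ifP => // /andP[_ /negPf ->].
Qed.

Lemma out_edge_heights N h (i : 'I_N) : descending N h ->
  out_edge [seq vert h k | k <- iota 0 N.+1] i = cut_edge h i.
Proof.
move=> hh; rewrite /out_edge out_edges_heights //.
by rewrite (nth_map 0) ?size_iota // nth_iota.
Qed.

(** * Sweeping from a path to its translate by corner flips *)

Definition raise (h : nat -> nat) (k : nat) : nat -> nat :=
  fun j => h j + (j == k).

(** The vertex of the path on line k can be moved up by (1,1): the path comes
    down to it and leaves it to the right, as far as these steps exist. *)
Definition flippable (N : nat) (h : nat -> nat) (k : nat) : bool :=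
  [&& k <= N, (0 < k) ==> (h k.-1 == (h k).+1) & (k < N) ==> (h k.+1 == h k)].

Fixpoint admissible (N : nat) (h : nat -> nat) (ks : seq nat) : bool :=
  if ks is k :: ks' then flippable N h k && admissible N (raise h k) ks'
  else true.

Fixpoint sweep (h : nat -> nat) (ks : seq nat) : seq vertex :=
  if ks is k :: ks' then vert (raise h k) k :: sweep (raise h k) ks' else [::].

Lemma foldl_raise h ks j : foldl raise h ks j = h j + count_mem j ks.
Proof.
elim: ks h => [|k ks IH] h /=; first by rewrite addn0.
by rewrite IH /raise eq_sym addnA.
Qed.

(** A line visited once is still at its initial height when visited. *)
Lemma sweep_uniq h ks : uniq ks -> sweep h ks = [seq vert (succn \o h) k | k <- ks].
Proof.
suff sweepE h0 : uniq ks -> {in ks, h0 =1 h} ->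
    sweep h0 ks = [seq vert (succn \o h) k | k <- ks].
  by move=> /sweepE; apply.
elim: ks h0 => [|k ks IH] h0 //= /andP[kks uks] eqh.
rewrite IH //.
  by rewrite /vert /raise eqxx addn1 /= eqh ?mem_head.
move=> j jks; rewrite /raise eqh ?inE ?jks ?orbT //.
by case: eqP => [ejk|]; rewrite ?addn0 //; rewrite -ejk jks in kks.
Qed.

(** The order in which vertices are sampled: by y, then by x. *)
Definition lexv (u v : vertex) : bool :=
  (u.2 < v.2) || (u.2 == v.2) && (u.1 < v.1).

(** Of two neighbouring lines k and k + 1, the sampling order visits k first
    when the path goes right between them, and k + 1 first when it goes down.
    So, when a line is reached, its neighbours have been raised exactly as far
    as needed for a corner.  The list [done] of lines already visited makes the
    induction go through: the remaining lines all come after them. *)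
Lemma admissible_sorted N h ks done :
  descending N h ->
  pairwise (relpre (vert (succn \o h)) lexv) ks ->
  allrel (relpre (vert (succn \o h)) lexv) done ks ->
  (forall j, (j <= N) = (j \in done) || (j \in ks)) ->
  forall h0, (forall j, h0 j = h j + (j \in done)) -> admissible N h0 ks.
Proof.
move=> hh; elim: ks done => //= k ks IH done /andP[kks pks] dks cover h0 h0E.
have /= dk := allrelP dks _ k _ (mem_head _ _).
have {}kks := allP kks.
have kdone : k \notin done by apply/negP=> /dk; rewrite /lexv /=; lia.
apply/andP; split; last first.
  apply: (IH (k :: done)) => //=.
  - rewrite allrel_consl; apply/andP; split; first exact/allP.
    by move: dks; rewrite allrel_consr => /andP[].
  - by move=> j; rewrite cover !inE orbCA orbA.
  - move=> j; rewrite /raise h0E inE -addnA; congr (_ + _).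
    by case: eqP => [->|] /=; rewrite ?(negPf kdone) ?addn0.
have kN : k <= N by rewrite cover mem_head orbT.
(* As every line up to N is either done or pending, the order alone decides
   which. *)
have done_lt j : j <= N -> j != k ->
    (j \in done) = lexv (vert (succn \o h) j) (vert (succn \o h) k).
  move=> jN jk; apply/idP/idP => [/dk //|ltjk].
  move: jN; rewrite cover inE (negPf jk) => /orP[//|/= /kks /=].
  by move: ltjk; rewrite /lexv /=; lia.
rewrite /flippable kN /= !h0E (negPf kdone) addn0.
apply/andP; split; apply/implyP => hk.
  rewrite done_lt; [|lia..].
  have := hh k.-1; rewrite prednK // => /(_ kN).
  by rewrite /lexv /=; case/orP=> /eqP E; rewrite E; lia.
rewrite done_lt; [|lia..].
by have := hh k hk; rewrite /lexv /=; case/orP=> /eqP E; rewrite E; lia.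
Qed.

Lemma shift_heights n N h :
  shift_path n [seq vert h k | k <- iota 0 N.+1] =
  [seq vert (addn^~ n \o h) k | k <- iota 0 N.+1].
Proof.
by rewrite /shift_path -map_comp; apply: eq_map => k; rewrite /vert /= addnA.
Qed.

Lemma has_line N h (p : nat -> bool) v :
  has (fun u => same_line u v && p u.2) [seq vert h k | k <- iota 0 N.+1] =
  [&& v.2 <= v.1, v.1 - v.2 <= N & p (h (v.1 - v.2))].
Proof.
rewrite has_map; apply/hasP/and3P => [[k]|[le1 le2 pk]].
  rewrite mem_iota /same_line /= => kN /andP[/eqP E pk].
  have Ek : v.1 - v.2 = k by lia.
  by rewrite Ek; split=> //; lia.
by exists (v.1 - v.2); rewrite ?mem_iota /same_line /= ?pk ?andbT; lia.
Qed.

Lemma pairwise_lexv_grid m n a b :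
  pairwise lexv [seq (x, y) | y <- iota a m, x <- iota b n].
Proof.
elim: m a => //= m IH a; rewrite pairwise_cat IH andbT; apply/andP; split.
  apply/allrelP=> _ _ /mapP[x _ ->] /allpairsP[[y x'] /= [+ _ ->]].
  by rewrite mem_iota /lexv /=; lia.
rewrite pairwise_map; have := iota_ltn_sorted b n.
rewrite (sorted_pairwise ltn_trans); apply: sub_pairwise => x y /=.
by rewrite /lexv /= ltnn eqxx.
Qed.

(** Each line contains one vertex strictly above P and weakly below P + (1,1),
    so the vertices between the two paths form one sweep over the lines. *)
Lemma between_heights N h : descending N h ->
  let P := [seq vert h k | k <- iota 0 N.+1] in
  exists ks, [/\ between P (shift_path 1 P) = sweep h ks, admissible N h ks,
    uniq ks & forall j, (j \in ks) = (j <= N)].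
Proof.
move=> hh P; set Q := shift_path 1 P; set L := between P Q.
have QE : Q = [seq vert (succn \o h) k | k <- iota 0 N.+1].
  by rewrite /Q shift_heights; apply: eq_map => k; rewrite /vert /= addn1.
have LP : pairwise lexv L by apply/pairwise_filter/pairwise_lexv_grid.
have memL v : (v \in L) = (v \in Q).
  have bounded : v \in Q -> v \in [seq (x, y) | y <- iota 0 (\max_(v <- Q) v.2).+1,
                                             x <- iota 0 (\max_(v <- Q) v.1).+1].
    move=> vQ; apply/allpairsP; exists (v.2, v.1); rewrite !mem_iota !ltnS /=.
    by split; [exact: leq_bigmax_seq|exact: leq_bigmax_seq|case: (v)].
  rewrite mem_filter /strictly_above /weakly_below.
  have [vQ|] := boolP (v \in Q).
    rewrite (bounded vQ) andbT; move: vQ; rewrite QE mem_heights.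
    rewrite (@has_line N h (fun y => y < v.2)).
    rewrite (@has_line N (succn \o h) (fun y => v.2 <= y)) /=.
    by case/and3P=> -> -> /eqP E; apply/andP; split; rewrite -?E ?leqnn //; lia.
  rewrite QE mem_heights (@has_line N h (fun y => y < v.2)).
  rewrite (@has_line N (succn \o h) (fun y => v.2 <= y)) /= => nQ.
  by apply/negP => /andP[]; lia.
pose ks := [seq v.1 - v.2 | v <- L].
have LE : L = [seq vert (succn \o h) k | k <- ks].
  rewrite -map_comp -[LHS]map_id; apply/eq_in_map => u.
  rewrite memL QE mem_heights => /and3P[le1 _ /eqP E].
  by rewrite /= /vert -E subnK // -surjective_pairing.
have pks : pairwise (relpre (vert (succn \o h)) lexv) ks.
  by rewrite -pairwise_map -LE.
have uks : uniq ks.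
  apply: (pairwise_uniq _ pks) => k /=; rewrite /lexv /=; lia.
have memks j : (j \in ks) = (j <= N).
  apply/mapP/idP => [[v + ->]|jN].
    by rewrite memL QE mem_heights => /and3P[].
  exists (vert (succn \o h) j); last by rewrite /= addnK.
  by rewrite memL QE map_f // mem_iota.
exists ks; split=> //; first by rewrite sweep_uniq.
apply: (@admissible_sorted N h ks [::]) => // j; last by rewrite addn0.
by rewrite memks.
Qed.

Local Open Scope ring_scope.

(** * The dynamics as a chain on the states of a moving path *)

Definition cut_state (N : nat) (h : nat -> nat) (w : config) : state N :=
  [ffun i : 'I_N => w (cut_edge h i)].

Definition occ (N : nat) (tau : state N) (j : nat) : bool :=
  oapp tau false (insub j).

Definition write (N : nat) (j : nat) (x : bool) (tau : state N) : state N :=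
  [ffun i : 'I_N => if i == j :> nat then x else tau i].

Lemma occ_cut_state N h w j :
  (j < N)%N -> occ (cut_state N h w) j = w (cut_edge h j).
Proof. by move=> jN; rewrite /occ insubT /= ffunE. Qed.

Lemma left_edge_flip N h k : flippable N h k -> (0 < k)%N ->
  cut_edge h k.-1 = left_in (vert (raise h k) k) /\
  cut_edge (raise h k) k.-1 = up_edge (vert (raise h k) k).
Proof.
case: k => // k /and3P[_ + _] _ => /eqP hk.
have r1 : raise h k.+1 k = (h k.+1).+1 by rewrite /raise hk ltn_eqF // addn0.
have r2 : raise h k.+1 k.+1 = (h k.+1).+1 by rewrite /raise eqxx addn1.
by rewrite /cut_edge /left_in /vert /= r1 r2 hk eqxx gtn_eqF // addnS.
Qed.

Lemma bottom_edge_flip N h k : flippable N h k -> (k < N)%N ->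
  cut_edge h k = bottom_in (vert (raise h k) k) /\
  cut_edge (raise h k) k = right_edge (vert (raise h k) k).
Proof.
case/and3P=> _ _ /implyP hk /hk /eqP {}hk.
have r1 : raise h k k = (h k).+1 by rewrite /raise eqxx addn1.
have r2 : raise h k k.+1 = h k by rewrite /raise gtn_eqF // addn0.
by rewrite /cut_edge /bottom_in /vert /= r1 r2 hk eqxx gtn_eqF // addnS.
Qed.

(** Sampling the new vertex rewrites only the sites k - 1 and k.  At k = 0 both
    writes hit site 0 and the later one, of the right edge, prevails; at k = N
    the write at site N has no effect.  This makes one formula valid in the
    bulk and at both boundaries. *)
Lemma cut_state_flip N h k w t r : flippable N h k ->
  cut_state N (raise h k) (set_out w (vert (raise h k) k) t r) =
  write k r (write k.-1 t (cut_state N h w)).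
Proof.
move=> flip; apply/ffunP => i; rewrite !ffunE /set_out.
have [ik|ik] := eqVneq (i : nat) k.
  have kN : (k < N)%N by rewrite -ik.
  have [_] := bottom_edge_flip flip kN; rewrite -{2}ik => ->.
  by rewrite eqxx; case: eqP.
have [ik1|ik1] := eqVneq (i : nat) k.-1.
  have k_gt0 : (0 < k)%N by lia.
  by have [_] := left_edge_flip flip k_gt0; rewrite -ik1 => ->; rewrite eqxx.
have -> : cut_edge (raise h k) i = cut_edge h i.
  by apply: eq_cut_edge; rewrite /raise; case: eqP => //; lia.
have gapv b : gap (vert (raise h k) k, b) = (k - b)%N by rewrite /gap /=; lia.
by case: eqP => [/(congr1 gap)|_]; [|case: eqP => [/(congr1 gap)|//]];
  rewrite gap_cut_edge gapv /=; lia.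
Qed.

(** The vertex (k, 0) stands for any vertex of line k, as the vertex weights
    depend on the line only. *)
Fixpoint flip_prob (R : pzRingType) (prm : rates R) (N : nat) (ks : seq nat)
    (tau tau' : state N) : R :=
  if ks is k :: ks' then
    \sum_(t : bool) \sum_(r : bool)
      vertex_prob prm N (k, 0%N) (occ tau k.-1) (occ tau k) t r
      * flip_prob prm ks' (write k r (write k.-1 t tau)) tau'
  else (tau == tau')%:R.

Lemma vertex_prob_line (R : pzRingType) (prm : rates R) N y k l b t r l' b' :
  ((0 < k)%N -> l = l') -> ((k < N)%N -> b = b') -> (0 < N)%N -> (k <= N)%N ->
  vertex_prob prm N ((k + y)%N, y) l b t r = vertex_prob prm N (k, 0%N) l' b' t r.
Proof.
rewrite /vertex_prob /left_boundary /right_boundary /= add0n.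
rewrite -[X in _ == X]add0n eqn_add2r addnC eqn_add2l.
case: k => [|k] El Eb N0 kN /=; first by rewrite Eb.
by rewrite El //; case: eqP => // ?; rewrite Eb //; lia.
Qed.

(** Although sampling acts on configurations of all edges, an admissible sweep
    only ever reads edges leaving the current path, so it factors through the
    states on these paths. *)
Lemma sample_prob_sweep (R : pzRingType) (prm : rates R) N h ks w tau' :
  (0 < N)%N -> admissible N h ks ->
  sample_prob prm N (sweep h ks) w
    (fun w' => cut_state N (foldl raise h ks) w' == tau') =
  flip_prob prm ks (cut_state N h w) tau'.
Proof.
move=> N0; elim: ks h w => //= k ks IH h w /andP[flip adm].
apply: eq_bigr => t _; apply: eq_bigr => r _; rewrite IH // cut_state_flip //.
congr (_ * _); apply: vertex_prob_line => // [k0|kN|]; last by case/and3P: flip.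
  have [<- _] := left_edge_flip flip k0; rewrite occ_cut_state //.
  by case/and3P: flip; lia.
by have [<- _] := bottom_edge_flip flip kN; rewrite occ_cut_state.
Qed.

Lemma eq_sample_prob (R : pzRingType) (prm : rates R) N vs w A B :
  A =1 B -> sample_prob prm N vs w A = sample_prob prm N vs w B.
Proof.
move=> AB; elim: vs w => [|v vs IH] w /=; first by rewrite AB.
by apply: eq_bigr => t _; apply: eq_bigr => r _; rewrite IH.
Qed.

Lemma cut_state_config_of N h tau : descending N h ->
  cut_state N h (config_of [seq vert h k | k <- iota 0 N.+1] tau) = tau.
Proof.
move=> hh; apply/ffunP => i; rewrite ffunE /config_of.
apply/existsP/idP => [[j /andP[/eqP + tauj]]|taui].
  rewrite out_edge_heights // => /(congr1 gap); rewrite !gap_cut_edge.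
  by move/val_inj <-.
by exists i; rewrite out_edge_heights // eqxx.
Qed.

Lemma particle_system_flips (R : pzRingType) (prm : rates R) N h :
  (0 < N)%N -> descending N h ->
  exists ks, [/\ admissible N h ks, uniq ks, (forall j, (j \in ks) = (j <= N)%N)
    & particle_system prm [seq vert h k | k <- iota 0 N.+1] =2
      @flip_prob R prm N ks].
Proof.
move=> N0 hh; have [ks [betweenE adm uks memks]] := between_heights hh.
exists ks; split=> // tau tau'.
rewrite /particle_system /transition betweenE -[in RHS](cut_state_config_of tau hh).
rewrite -sample_prob_sweep //; apply: eq_sample_prob => w; congr (_ == _).
rewrite shift_heights; apply/ffunP => i; rewrite !ffunE out_edge_heights.
  congr (w _); apply: eq_cut_edge; rewrite foldl_raise count_uniq_mem // memks.
    by rewrite (ltnW (ltn_ord i)).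
  by rewrite (ltn_ord i).
by move=> k kN /=; have := hh k kN; lia.
Qed.

(** * Parity of the number of particles *)

Definition on_boundary (N k : nat) : bool := (k == 0%N) || (k == N).

Lemma odd_write N j x (tau : state N) : (j < N)%N ->
  odd (num_particles (write j x tau)) =
  odd (num_particles tau) (+) occ tau j (+) x.
Proof.
move=> jN; pose i := Ordinal jN; rewrite /num_particles /occ insubT /=.
rewrite (bigD1 i) // [in RHS](bigD1 i) //= ffunE eqxx.
rewrite (eq_bigr (fun i => nat_of_bool (tau i))) => [|i' ii']; last first.
  by rewrite ffunE (negPf ii' : (i' == j :> nat) = false).
by rewrite !oddD !oddb; case: x (tau _) (odd _) => [] [] [].
Qed.

Lemma occ_write N i j x (tau : state N) : (i < N)%N ->
  occ (write j x tau) i = if i == j then x else occ tau i.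
Proof. by move=> iN; rewrite /occ insubT /= ffunE. Qed.

Lemma write_id N j x y (tau : state N) : write j x (write j y tau) = write j x tau.
Proof. by apply/ffunP => i; rewrite !ffunE; case: eqP. Qed.

Lemma writeC N i j x y (tau : state N) : i != j ->
  write i x (write j y tau) = write j y (write i x tau).
Proof.
by move=> ij; apply/ffunP => l; rewrite !ffunE; case: eqP => // ->; rewrite (negPf ij).
Qed.

Lemma write_out N j x (tau : state N) : (N <= j)%N -> write j x tau = tau.
Proof. by move=> Nj; apply/ffunP => i; rewrite ffunE ltn_eqF // (leq_trans _ Nj). Qed.

(** A bulk vertex conserves arrows; with all boundary rates equal to 1 a
    boundary vertex outputs the complement of its input. *)
Lemma odd_flip (R : pzRingType) (th1 th2 : R) N k (tau : state N) t r :
  (0 < N)%N -> (k <= N)%N ->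
  vertex_prob (Rates 1 1 1 1 th1 th2) N (k, 0%N) (occ tau k.-1) (occ tau k) t r != 0 ->
  odd (num_particles (write k r (write k.-1 t tau))) =
  odd (num_particles tau) (+) on_boundary N k.
Proof.
rewrite /vertex_prob /left_boundary /right_boundary /bernoulli_prob /on_boundary.
move=> N0 kN /=; rewrite add0n subrr.
case: k kN => [|k] kN /=.
  rewrite write_id odd_write //.
  by case: t r (occ tau 0) (odd _) => [] [] [] []; rewrite ?subrr ?eqxx.
have [->|kN'] := eqVneq k.+1 N.
  rewrite write_out // odd_write //.
  by case: t r (occ tau _) (odd _) => [] [] [] []; rewrite ?subrr ?eqxx.
rewrite !odd_write ?occ_write; try lia.
rewrite (gtn_eqF (ltnSn k)).
by case: t r (occ tau k) (occ tau k.+1) (odd _) => [] [] [] [] []; rewrite ?subrr ?eqxx.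
Qed.

Lemma flip_prob_parity (R : pzRingType) (th1 th2 : R) N ks (tau tau' : state N) :
  (0 < N)%N -> {in ks, forall k, (k <= N)%N} ->
  odd (num_particles tau') !=
    odd (num_particles tau) (+) odd (count (on_boundary N) ks) ->
  flip_prob (Rates 1 1 1 1 th1 th2) ks tau tau' = 0.
Proof.
move=> N0; elim: ks tau => [|k ks IH] tau ksN /=.
  by rewrite addbF; have [->|] := eqVneq tau tau'; rewrite ?eqxx.
move=> parity; apply: big1 => t _; apply: big1 => r _.
set p := vertex_prob _ _ _ _ _ _ _.
have [->|p0] := eqVneq p 0; first by rewrite mul0r.
rewrite IH ?mulr0 // => [j jks|]; first by apply: ksN; rewrite inE jks orbT.
rewrite (odd_flip N0 _ p0) ?ksN ?mem_head //.
by move: parity; rewrite oddD oddb addbA.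
Qed.

Lemma odd_count_boundary N ks : (0 < N)%N -> uniq ks ->
  (forall j, (j \in ks) = (j <= N)%N) -> odd (count (on_boundary N) ks) = false.
Proof.
move=> N0 uks memks.
have := count_predUI (pred1 0%N) (pred1 N) ks.
rewrite [X in (_ + X)%N](_ : _ = 0%N) ?addn0.
  by rewrite !count_uniq_mem // !memks leqnn leq0n => ->.
by rewrite -[RHS](count_pred0 ks); apply: eq_count => j /=; lia.
Qed.

(** * Product measures under one flip *)

Lemma bernoulli_probT (R : pzRingType) (p : R) : \sum_x bernoulli_prob p x = 1.
Proof. by rewrite big_bool /= addrC subrK. Qed.

(** Replacing coordinate j by an independent one of law q j turns the product
    measure p into q.  The bijection behind it exchanges the old value of the
    coordinate with the new one, on pairs of a state and a fresh value.  The
    case p = q exposes a coordinate as an explicit independent variable. *)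
Lemma resample (R : comPzRingType) N (j : 'I_N) (p q : 'I_N -> R) (F : state N -> R) :
  (forall i, i != j -> p i = q i) ->
  \sum_tau bernoulli_product p tau *
    (\sum_x bernoulli_prob (q j) x * F (write j x tau)) =
  \sum_tau bernoulli_product q tau * F tau.
Proof.
move=> pq.
pose rest (tau : state N) := \prod_(i < N | i != j) bernoulli_prob (q i) (tau i).
have pE tau : bernoulli_product p tau = bernoulli_prob (p j) (tau j) * rest tau.
  rewrite /bernoulli_product (bigD1 j) //=; congr (_ * _).
  by apply: eq_bigr => i /pq ->.
have qE tau : bernoulli_product q tau = bernoulli_prob (q j) (tau j) * rest tau.
  by rewrite /bernoulli_product (bigD1 j).
have restW x tau : rest (write j x tau) = rest tau.
  by apply: eq_bigr => i ij; rewrite ffunE (negPf ij : (i == j :> nat) = false).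
have writeT x tau : write j x tau j = x by rewrite ffunE eqxx.
pose swap (s : state N * bool) := (write j s.2 s.1, s.1 j).
have swapK : involutive swap.
  case=> tau x; rewrite /swap /= writeT write_id; congr (_, _).
  by apply/ffunP => i; rewrite ffunE; case: eqP => // /val_inj ->.
pose W (s : state N * bool) := bernoulli_prob (p j) (s.1 j) * rest s.1 *
  (bernoulli_prob (q j) s.2 * F (write j s.2 s.1)).
transitivity (\sum_s W s).
  rewrite -(pair_bigA _ (fun tau x => W (tau, x))) /=.
  by apply: eq_bigr => tau _; rewrite pE mulr_sumr.
rewrite (reindex_inj (inv_inj swapK)) /=.
rewrite -(pair_bigA _ (fun tau x => W (swap (tau, x)))) /=.
apply: eq_bigr => tau _; rewrite -[RHS]mul1r -(bernoulli_probT (p j)) mulr_suml.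
apply: eq_bigr => x _; have := swapK (tau, x); rewrite /swap /W /= => -[-> _].
by rewrite writeT restW qE !mulrA; congr (_ * _); rewrite mulrAC.
Qed.

Lemma resample2 (R : comPzRingType) N (i j : 'I_N) (p q : 'I_N -> R)
    (F : state N -> R) :
  i != j -> (forall l, l != i -> l != j -> p l = q l) ->
  \sum_tau bernoulli_product p tau *
    (\sum_x \sum_y bernoulli_prob (q i) x * bernoulli_prob (q j) y *
       F (write j y (write i x tau))) =
  \sum_tau bernoulli_product q tau * F tau.
Proof.
move=> ij pq; pose m l := if l == i then q l else p l.
rewrite -(@resample _ _ j m q) => [|l lj]; last first.
  by rewrite /m; case: ifP => // /negbT li; apply: pq.
rewrite -(@resample _ _ i p m) => [|l li]; last by rewrite /m (negPf li).
apply: eq_bigr => tau _; congr (_ * _); apply: eq_bigr => x _.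
rewrite mulr_sumr; apply: eq_bigr => y _.
by rewrite /m eqxx mulrA.
Qed.

Definition edge_law (R : Type) (pu pr : R) (h : nat -> nat) (i : nat) : R :=
  if vertical (cut_edge h i) then pu else pr.

Lemma edge_law_raise (R : Type) (pu pr : R) h k i :
  i != k -> i != k.-1 -> edge_law pu pr h i = edge_law pu pr (raise h k) i.
Proof.
move=> ik ik1; rewrite /edge_law (@eq_cut_edge h (raise h k)) // /raise.
  by rewrite (negPf ik) addn0.
by case: eqP; rewrite ?addn0 //; lia.
Qed.

Lemma edge_law_left (R : Type) (pu pr : R) N h k :
  flippable N h k -> (0 < k)%N ->
  edge_law pu pr h k.-1 = pr /\ edge_law pu pr (raise h k) k.-1 = pu.
Proof. by rewrite /edge_law => flip k0; have [-> ->] := left_edge_flip flip k0. Qed.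

Lemma edge_law_right (R : Type) (pu pr : R) N h k :
  flippable N h k -> (k < N)%N ->
  edge_law pu pr h k = pu /\ edge_law pu pr (raise h k) k = pr.
Proof. by rewrite /edge_law => flip kN; have [-> ->] := bottom_edge_flip flip kN. Qed.

(** If exactly one arrow leaves, then exactly one came in.  For instance the
    output with an arrow on top only has probability
    pu^2 theta1 + pr^2 (1 - theta2), which the balance hypothesis turns into
    pu^2 = pu (1 - pr). *)
Lemma bulk_balance (R : comPzRingType) (th1 th2 pu pr : R) N k t r :
  pu + pr = 1 -> pr ^+ 2 * (1 - th2) = pu ^+ 2 * (1 - th1) -> (0 < k < N)%N ->
  \sum_l \sum_b bernoulli_prob pr l * bernoulli_prob pu b *
    vertex_prob (Rates 1 1 1 1 th1 th2) N (k, 0%N) l b t r =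
  bernoulli_prob pu t * bernoulli_prob pr r.
Proof.
move=> pur e /andP[k0 kN].
rewrite /vertex_prob /left_boundary /right_boundary /= gtn_eqF // ltn_eqF //.
rewrite !big_bool /bernoulli_prob /=.
have -> : 1 - pu = pr by rewrite -pur; ring.
have -> : 1 - pr = pu by rewrite -pur; ring.
case: t r => [] [] /=.
- ring.
- transitivity (pu ^+ 2 * th1 + pr ^+ 2 * (1 - th2)); first ring.
  by rewrite e; ring.
- transitivity (pr ^+ 2 * th2 + pu ^+ 2 * (1 - th1)); first ring.
  by rewrite -e; ring.
- ring.
Qed.

Lemma left_balance (R : comPzRingType) (th1 th2 pu pr : R) N l t r :
  pu + pr = 1 ->
  \sum_b bernoulli_prob pu b *
    vertex_prob (Rates 1 1 1 1 th1 th2) N (0, 0)%N l b t r =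
  (~~ t)%:R * bernoulli_prob pr r.
Proof.
move=> pur; rewrite /vertex_prob /= big_bool /bernoulli_prob /=.
have -> : 1 - pu = pr by rewrite -pur; ring.
have -> : 1 - pr = pu by rewrite -pur; ring.
by case: t r => [] [] /=; ring.
Qed.

Lemma right_balance (R : comPzRingType) (th1 th2 pu pr : R) N b t r :
  (0 < N)%N -> pu + pr = 1 ->
  \sum_l bernoulli_prob pr l *
    vertex_prob (Rates 1 1 1 1 th1 th2) N (N, 0)%N l b t r =
  (~~ r)%:R * bernoulli_prob pu t.
Proof.
move=> N0 pur; rewrite /vertex_prob /left_boundary /right_boundary /=.
rewrite gtn_eqF // eqxx big_bool /bernoulli_prob /=.
have -> : 1 - pu = pr by rewrite -pur; ring.
have -> : 1 - pr = pu by rewrite -pur; ring.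
by case: t r => [] [] /=; ring.
Qed.

(** Both sides are brought to the form of an average, over the same product
    measure, of an expression in which the sites k - 1 and k are explicit
    independent variables: the inputs of the vertex on the left, its outputs on
    the right.  The balance lemmas identify the two integrands. *)
Lemma flip_stationary (R : comPzRingType) (th1 th2 pu pr : R) N h k
    (F : state N -> R) :
  pu + pr = 1 -> pr ^+ 2 * (1 - th2) = pu ^+ 2 * (1 - th1) ->
  (0 < N)%N -> flippable N h k ->
  \sum_tau bernoulli_product (fun i => edge_law pu pr h i) tau *
    (\sum_t \sum_r
       vertex_prob (Rates 1 1 1 1 th1 th2) N (k, 0%N) (occ tau k.-1) (occ tau k) t r
       * F (write k r (write k.-1 t tau))) =
  \sum_tau bernoulli_product (fun i => edge_law pu pr (raise h k) i) tau * F tau.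
Proof.
move=> pur e N0 flip; set prm := Rates _ _ _ _ _ _.
set p : 'I_N -> R := fun i => _; set q : 'I_N -> R := fun i => edge_law _ _ _ i.
have kN : (k <= N)%N by case/and3P: flip.
have pq (i : 'I_N) : i != k :> nat -> i != k.-1 :> nat -> p i = q i.
  exact: edge_law_raise.
have [k0|k0] := posnP k.
  (* Left boundary: only site 0 is involved. *)
  subst k; pose j := Ordinal N0.
  have [pj qj] := edge_law_right pu pr flip N0.
  have pqj i : i != j -> p i = q i by rewrite -val_eqE => ij; apply: pq.
  rewrite -(@resample _ _ j p p) // -(@resample _ _ j p q) //.
  apply: eq_bigr => tau _; congr (_ * _).
  rewrite [p j]pj [q j]qj.
  transitivity (\sum_t \sum_r (\sum_b bernoulli_prob pu b *
      vertex_prob prm N (0, 0)%N b b t r) * F (write 0 r tau)).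
    under eq_bigr => b _ do rewrite mulr_sumr.
    rewrite exchange_big; apply: eq_bigr => t _.
    under eq_bigr => b _ do rewrite mulr_sumr.
    rewrite exchange_big; apply: eq_bigr => r _.
    rewrite mulr_suml; apply: eq_bigr => b _.
    by rewrite !write_id occ_write // eqxx mulrA.
  rewrite big_bool /= [X in X + _]big1 ?add0r => [|r _].
    apply: eq_bigr => r _; congr (_ * _).
    by rewrite -[RHS]mul1r -(left_balance th1 th2 N false false r pur).
  rewrite [X in X * _](_ : _ = 0) ?mul0r //.
  rewrite -[RHS](mul0r (bernoulli_prob pr r)).
  by rewrite -(left_balance th1 th2 N false true r pur).
have [kN'|kN'] := eqVneq k N.
  (* Right boundary: only site N - 1 is involved, and the weight ignores the
     bottom edge, here declared empty. *)
  have k1N : (k.-1 < N)%N by lia.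
  pose j := Ordinal k1N.
  have [pj qj] := edge_law_left pu pr flip k0.
  have pqj i : i != j -> p i = q i.
    by rewrite -val_eqE => ij; apply: pq => //; rewrite kN' ltn_eqF.
  rewrite -(@resample _ _ j p p) // -(@resample _ _ j p q) //.
  apply: eq_bigr => tau _; congr (_ * _).
  rewrite [p j]pj [q j]qj.
  transitivity (\sum_t \sum_r (\sum_l bernoulli_prob pr l *
      vertex_prob prm N (k, 0)%N l false t r) * F (write k.-1 t tau)).
    under eq_bigr => b _ do rewrite mulr_sumr.
    rewrite exchange_big; apply: eq_bigr => t _.
    under eq_bigr => b _ do rewrite mulr_sumr.
    rewrite exchange_big; apply: eq_bigr => r _.
    rewrite mulr_suml; apply: eq_bigr => b _.
    rewrite (write_out _ _ (eq_leq (esym kN'))) write_id occ_write // eqxx mulrA.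
    by rewrite /vertex_prob /left_boundary /right_boundary /= gtn_eqF // kN' eqxx.
  apply: eq_bigr => t _; rewrite big_bool /= kN'.
  by rewrite !(right_balance _ _ _ _ _ N0 pur) /= !mul0r add0r mul1r.
have lt_kN : (k < N)%N by lia.
have k1N : (k.-1 < N)%N by lia.
pose i := Ordinal k1N; pose j := Ordinal lt_kN.
have ij : i != j by rewrite -val_eqE /=; lia.
have [pi qi] := edge_law_left pu pr flip k0.
have [pj qj] := edge_law_right pu pr flip lt_kN.
rewrite -(@resample2 _ _ i j p p) // -(@resample2 _ _ i j p q) //; last first.
  by move=> l; rewrite -!val_eqE /= => li lj; apply: pq.
apply: eq_bigr => tau _; congr (_ * _).
rewrite [p i]pi [p j]pj [q i]qi [q j]qj.
transitivity (\sum_t \sum_r (\sum_l \sum_b bernoulli_prob pr l * bernoulli_prob pu b *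
    vertex_prob prm N (k, 0)%N l b t r) * F (write k r (write k.-1 t tau))).
  under eq_bigr => l _ do
    (under eq_bigr => b _ do rewrite mulr_sumr; rewrite exchange_big).
  rewrite exchange_big; apply: eq_bigr => t _.
  under eq_bigr => l _ do
    (under eq_bigr => b _ do rewrite mulr_sumr; rewrite exchange_big).
  rewrite exchange_big; apply: eq_bigr => r _.
  rewrite mulr_suml; apply: eq_bigr => l _; rewrite mulr_suml; apply: eq_bigr => b _.
  rewrite !occ_write // eqxx (_ : k.-1 == k = false) ?eqxx; last by lia.
  rewrite mulrA; congr (_ * F _); rewrite (@writeC _ k.-1 k) /=; last by lia.
  by rewrite !write_id.
by apply: eq_bigr => t _; apply: eq_bigr => r _; rewrite bulk_balance // k0.
Qed.

Lemma flip_prob_stationary (R : comPzRingType) (th1 th2 pu pr : R) N h ks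
    (tau' : state N) :
  pu + pr = 1 -> pr ^+ 2 * (1 - th2) = pu ^+ 2 * (1 - th1) ->
  (0 < N)%N -> admissible N h ks ->
  \sum_tau bernoulli_product (fun i => edge_law pu pr h i) tau *
    flip_prob (Rates 1 1 1 1 th1 th2) ks tau tau' =
  bernoulli_product (fun i => edge_law pu pr (foldl raise h ks) i) tau'.
Proof.
move=> pur e N0; elim: ks h => [|k ks IH] h /=.
  rewrite (bigD1 tau') //= eqxx mulr1 big1 ?addr0 // => tau /negPf ->.
  by rewrite mulr0.
case/andP=> flip adm; rewrite -IH // -(flip_stationary _ pur e N0 flip) //.
Qed.

(** * Stationarity on a down-right path *)

Lemma bernoulli_product_gt0 (R : numDomainType) N (p : 'I_N -> R) tau :
  (forall i, 0 < p i < 1) -> 0 < bernoulli_product p tau.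
Proof.
move=> p01; apply: prodr_gt0 => i _; have /andP[p0 p1] := p01 i.
by rewrite /bernoulli_prob; case: ifP; rewrite ?subr_gt0.
Qed.

Lemma sum_bernoulli_product (R : comPzRingType) N (p : 'I_N -> R) :
  \sum_tau bernoulli_product p tau = 1.
Proof.
rewrite -(bigA_distr_bigA (fun i x => bernoulli_prob (p i) x)).
by apply: big1 => i _; exact: bernoulli_probT.
Qed.

(** A class of states that the chain neither leaves nor enters splits off from
    a stationary measure that charges it. *)
Lemma stationary_restrict (R : numFieldType) (prm : rates R) N P
    (mu : state N -> R) (A : pred (state N)) :
  stationary_measure prm P mu ->
  (forall tau tau', particle_system prm P tau tau' != 0 -> A tau = A tau') ->
  \sum_(sigma | A sigma) mu sigma != 0 ->
  stationary_measure prm P (restrict_measure mu A).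
Proof.
move=> [[mu0 _] muP] AP; set Z := \sum_(_ | _) _ => Z0; rewrite /restrict_measure.
split; first split=> [tau|].
- by case: ifP => // _; rewrite divr_ge0 // sumr_ge0.
- by rewrite -big_mkcond -mulr_suml divff.
move=> tau'; case: ifP => A'.
  rewrite -muP mulr_suml; apply: eq_bigr => tau _.
  have [->|/AP ->] := eqVneq (particle_system prm P tau tau') 0.
    by rewrite !mulr0 mul0r.
  by rewrite A' mulrAC.
apply: big1 => tau _.
have [->|/AP ->] := eqVneq (particle_system prm P tau tau') 0; first by rewrite mulr0.
by rewrite A' mul0r.
Qed.

Lemma particle_system_parity (R : pzRingType) (th1 th2 : R) N P (tau tau' : state N) :
  (0 < N)%N -> downright_path N P ->
  particle_system (Rates 1 1 1 1 th1 th2) P tau tau' != 0 ->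
  odd (num_particles tau') = odd (num_particles tau).
Proof.
move=> N0 /downright_path_heights[h -> hh].
have [ks [_ uks memks ->]] := particle_system_flips (Rates 1 1 1 1 th1 th2) N0 hh.
move=> nz; apply/eqP; apply: contraNT nz => parity.
rewrite flip_prob_parity // => [k|]; first by rewrite memks.
by rewrite odd_count_boundary // addbF.
Qed.

Lemma stationary_bernoulli (R : numDomainType) (th1 th2 pu pr : R) N P :
  pu + pr = 1 -> pr ^+ 2 * (1 - th2) = pu ^+ 2 * (1 - th1) ->
  0 < pu -> 0 < pr -> (0 < N)%N -> downright_path N P ->
  stationary_measure (Rates 1 1 1 1 th1 th2) P
    (bernoulli_product (fun i : 'I_N => if vertical (out_edge P i) then pu else pr)).
Proof.
move=> pur e pu0 pr0 N0 /downright_path_heights[h -> hh].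
split; first split; [move=> tau|exact: sum_bernoulli_product|].
  apply/ltW/bernoulli_product_gt0 => i.
  by case: ifP => _; rewrite -pur ?pu0 ?pr0 /= ?ltrDl ?ltrDr.
have [ks [adm uks memks systemE]] :=
  particle_system_flips (Rates 1 1 1 1 th1 th2) N0 hh.
have lawE (tau : state N) : bernoulli_product (fun i : 'I_N =>
    if vertical (out_edge [seq vert h k | k <- iota 0 N.+1] i) then pu else pr) tau
    = bernoulli_product (fun i => edge_law pu pr h i) tau.
  by apply: eq_bigr => i _; rewrite out_edge_heights.
move=> tau'; under eq_bigr => tau _ do rewrite lawE systemE.
rewrite lawE flip_prob_stationary //; apply: eq_bigr => i _.
(* All heights have been raised by one, so no edge has changed direction. *)
congr bernoulli_prob; rewrite /edge_law !vertical_cut_edge !foldl_raise.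
rewrite !count_uniq_mem // !memks (ltnW (ltn_ord i)) (ltn_ord i).
by rewrite eqn_add2r.
Qed.

Theorem corollary2p12 (R : rcfType) (N : nat) (theta1 theta2 : R)
    (hN : (1 <= N)%N)
    (htheta1 : 0 <= theta1 <= 1) (htheta2 : 0 <= theta2 <= 1) :
  let prm := Rates 1 1 1 1 theta1 theta2 in
  (forall P : seq vertex, downright_path N P ->
     forall tau tau' : state N, particle_system prm P tau tau' != 0 ->
       odd (num_particles tau') = odd (num_particles tau)) /\
  ((1 - theta1) * (1 - theta2) != 0 ->
   forall P : seq vertex, downright_path N P ->
     let s := Num.sqrt (1 - theta1) + Num.sqrt (1 - theta2) in
     let p_up := Num.sqrt (1 - theta2) / s in
     let p_right := Num.sqrt (1 - theta1) / s in
     let mu := bernoulli_product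
       (fun i : 'I_N => if vertical (out_edge P i) then p_up else p_right) in
     [/\ stationary_measure prm P mu,
         stationary_measure prm P
           (restrict_measure mu (fun tau => ~~ odd (num_particles tau)))
       & stationary_measure prm P
           (restrict_measure mu (fun tau => odd (num_particles tau)))]).
Proof.
move=> prm; split=> [P pathP tau tau'|nz P pathP s p_up p_right mu].
  exact: particle_system_parity.
have parity tau tau' := @particle_system_parity _ theta1 theta2 N P tau tau' hN pathP.
move: nz; rewrite mulf_eq0 negb_or => /andP[nz1 nz2].
have th1 : 0 < 1 - theta1 by rewrite lt0r nz1 subr_ge0; case/andP: htheta1.
have th2 : 0 < 1 - theta2 by rewrite lt0r nz2 subr_ge0; case/andP: htheta2.
have s_gt0 : 0 < s by rewrite addr_gt0 ?sqrtr_gt0.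
have pu0 : 0 < p_up by rewrite divr_gt0 ?sqrtr_gt0.
have pr0 : 0 < p_right by rewrite divr_gt0 ?sqrtr_gt0.
have pur : p_up + p_right = 1.
  by rewrite -mulrDl addrC divff ?gt_eqF.
have balance : p_right ^+ 2 * (1 - theta2) = p_up ^+ 2 * (1 - theta1).
  by rewrite !expr_div_n !sqr_sqrtr ?ltW // mulrAC [X in X / _]mulrC mulrAC.
have muP : stationary_measure prm P mu by exact: stationary_bernoulli.
have mass (A : pred (state N)) tau : A tau -> \sum_(sigma | A sigma) mu sigma != 0.
  have mu_gt0 sigma : 0 < mu sigma.
    apply: bernoulli_product_gt0 => i.
    by case: ifP => _; rewrite -pur ?pu0 ?pr0 /= ?ltrDl ?ltrDr.
  move=> Atau; rewrite (bigD1 tau) //= gt_eqF // ltr_wpDr // sumr_ge0 // => sigma _.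
  exact: ltW.
split=> //; apply: stationary_restrict => //.
- by move=> tau tau' /parity ->.
  (* The empty state is even, the state with one particle at site 0 is odd. *)
- apply: (mass _ [ffun=> false]).
  by rewrite /num_particles big1 // => i _; rewrite ffunE.
- by move=> tau tau' /parity ->.
- apply: (mass _ [ffun i : 'I_N => i == 0%N :> nat]).
  rewrite /num_particles (bigD1 (Ordinal hN)) //= ffunE /= big1 // => i.
  by rewrite -val_eqE /= ffunE => /negPf ->.
Qed.
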